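(* Let $G$ be a forest and $s>0$. Then for any $n\ge1$ agents with arbitrary monotone (continuous, nonnegative) valuations, a maximin allocation exists; that is, there is an $s$-separated allocation $(A_1,\dots,A_n)$ with $v_i(A_i)\ge\mathrm{MMS}_i^{n,s}$ for all $i$.
   Context: Cake model: the cake is a finite undirected graph $G=(V,E)$, possibly disconnected, in which every edge is a segment of positive length; points of $G$ are its vertices and the points on its edges. A piece of cake is a finite union of intervals contained in edges, together possibly with some vertices. A piece $X$ is connected if any two points of $X$ can be joined by a path in $G$ that stays inside $X$. Each agent $i\in[n]$ has a valuation $v_i$ on pieces that is nonnegative, monotone and continuous; in particular, points have value $0$. Distances: $\mathrm{Dist}^G(x,y)$ is the length of a shortest path along the edges, and is $\infty$ if $x$ and $y$ lie in different components. For sets, $\mathrm{Dist}^G(X,Y)=\inf_{x\in X,y\in Y}\mathrm{Dist}^G(x,y)$. Separation: a $k$-partition is $s$-separated if it consists of $k$ pairwise disjoint connected pieces $P_1,\dots,P_k$ (not necessarily covering $G$) with $\mathrm{Dist}^G(P_i,P_j)\ge s$ for all $i\ne j$. An $s$-separated allocation is a vector $(A_1,\dots,A_n)$ of connected pieces satisfying the same condition. Maximin share: $\mathrm{MMS}_i^{k,s}=\sup\min_{j\in[k]}v_i(P_j)$, where the supremum ranges over $s$-separated $k$-partitions. *)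

(* Defs.v *)
From HB Require Import structures.
From mathcomp Require Import all_boot all_order all_algebra.
From mathcomp Require Import all_classical all_reals all_analysis.
Set Implicit Arguments. Unset Strict Implicit. Unset Printing Implicit Defensive.
Import Order.TTheory GRing.Theory Num.Theory.
Local Open Scope classical_set_scope.
Local Open Scope ring_scope.

(* The cake: a finite undirected (multi)graph with vertex type V, edge type E,
   endpoints src e, tgt e (orientation irrelevant) and edge lengths len e. *)
Section Cake.
Context {R : realType} {V E : finType} (src tgt : E -> V) (len : E -> R).

(* Points of G: vertices, and interior points of edges (PE e t with 0<t<len e). *)
Inductive cake_pt := PV of V | PE of E & R.

Definition emb (e : E) (t : R) : cake_pt :=
  if t == 0 then PV (src e) else if t == len e then PV (tgt e) else PE e t.

Definition piece (X : set cake_pt) : Prop :=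
  exists (ints : seq (E * interval R)) (vs : seq V),
    forall x, X x <->
      ((exists2 ei, ei \in ints &
          exists t, t \in ei.2 /\ 0 <= t <= len ei.1 /\ x = emb ei.1 t)
       \/ (exists2 v, v \in vs & x = PV v)).

(* A straight segment along an edge: (e, a, b) goes from coordinate a to b. *)
Definition seg := (E * R * R)%type.
Definition seg_ok (s : seg) : Prop :=
  0 <= s.1.2 <= len s.1.1 /\ 0 <= s.2 <= len s.1.1.
Definition seg_set (s : seg) : set cake_pt :=
  [set emb s.1.1 t | t in `[Num.min s.1.2 s.2, Num.max s.1.2 s.2]].
Definition seg_len (s : seg) : R := `|s.2 - s.1.2|.

Fixpoint walk (x y : cake_pt) (w : seq seg) : Prop :=
  match w with
  | [::] => x = y
  | s :: w' => seg_ok s /\ emb s.1.1 s.1.2 = x /\ walk (emb s.1.1 s.2) y w'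
  end.
Definition walk_len (w : seq seg) : R := \sum_(s <- w) seg_len s.

Definition connected_piece (X : set cake_pt) : Prop :=
  forall x y, X x -> X y ->
    exists w, walk x y w /\ (forall s, s \in w -> seg_set s `<=` X).

(* Shortest-path distance (+oo if no path), and distance between sets. *)
Definition Dist (x y : cake_pt) : \bar R :=
  ereal_inf [set (walk_len w)%:E | w in [set w | walk x y w]].
Definition setDist (X Y : set cake_pt) : \bar R :=
  ereal_inf [set d | exists x y, X x /\ Y y /\ d = Dist x y].

Definition cake_separated (k : nat) (s : R) (P : 'I_k -> set cake_pt) : Prop :=
  (forall j, piece (P j) /\ connected_piece (P j)) /\
  (forall i j, i != j -> P i `&` P j = set0 /\ (s%:E <= setDist (P i) (P j))%E).

Definition symdiff_len (X Y : set cake_pt) : \bar R :=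
  (\sum_(e : E) (@lebesgue_measure R)
      [set t : R | (0 < t < len e)%R /\ ~ (X (PE e t) <-> Y (PE e t))])%E.

Definition cake_valuation (v : set cake_pt -> R) : Prop :=
  (forall X, piece X -> 0 <= v X) /\
  (forall X Y, piece X -> piece Y -> X `<=` Y -> v X <= v Y) /\
  (forall X, piece X -> forall eps : R, 0 < eps -> exists2 delta : R, 0 < delta &
     forall Y, piece Y -> (symdiff_len X Y < delta%:E)%E -> `|v X - v Y| < eps) /\
  (forall u, v [set PV u] = 0) /\
  (forall e t, 0 < t < len e -> v [set PE e t] = 0).

Definition min_value (v : set cake_pt -> R) (k : nat) (P : 'I_k -> set cake_pt) : \bar R :=
  ereal_inf [set (v (P j))%:E | j in [set: 'I_k]].
Definition cake_MMS (v : set cake_pt -> R) (k : nat) (s : R) : \bar R :=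
  ereal_sup [set @min_value v k P | P in [set P : 'I_k -> set cake_pt | cake_separated s P]].

End Cake.

(* Forests: graphs with no cycle (a loop and a pair of parallel edges count as
   cycles of length 1 and 2). *)
Definition joins {V E : finType} (src tgt : E -> V) (e : E) (u w : V) : bool :=
  ((src e == u) && (tgt e == w)) || ((src e == w) && (tgt e == u)).
Definition has_cycle {V E : finType} (src tgt : E -> V) : Prop :=
  exists (k : nat) (f : 'I_k.+1 -> E) (g : 'I_k.+1 -> V),
    injective f /\ injective g /\
    forall i : 'I_k.+1, joins src tgt (f i) (g i) (g (ordS i)).
Definition cake_forest {V E : finType} (src tgt : E -> V) : Prop := ~ has_cycle src tgt.

(* Main.v *)
(* Root every tree of the forest, so that any point has a unique ancestor at each
   smaller depth. Connected pieces are then the sets which, with two points, contain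
   both upward paths to a common ancestor, and the distance between two points is
   read off the depth of such ancestors.

   First, every maximin share is attained: the limit of an optimizing sequence of
   partitions along an ultrafilter is again a separated partition, and the lengths
   of the parts of the original pieces outside their limits tend to 0.

   Next, say that two pieces conflict if they are at distance less than s. Among
   finitely many pieces take one whose top is deepest: any two pieces in conflict
   with it are in conflict with each other. Given a maximin partition of each agent,
   hand the piece with the deepest top to its owner; it conflicts with at most one
   piece of every other agent, so the remaining agents still have enough pieces, and
   induction applies. Thus each agent receives a part of their own partition. *)

Require Import Defs.
From HB Require Import structures.
From mathcomp Require Import all_boot all_order all_algebra.
From mathcomp Require Import all_classical all_reals all_analysis.
From mathcomp Require Import measurable_realfun ring lra zify.
Set Implicit Arguments. Unset Strict Implicit. Unset Printing Implicit Defensive.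
Import Order.TTheory GRing.Theory Num.Theory numFieldNormedType.Exports.
Local Open Scope classical_set_scope.
Local Open Scope ring_scope.

(** * Rooting a forest *)

Lemma joins_eq_ends {V E : finType} (src tgt : E -> V) e u w u' w' :
  joins src tgt e u w -> joins src tgt e u' w' ->
  (u = u' /\ w = w') \/ (u = w' /\ w = u').
Proof.
by move=> /orP[]/andP[/eqP<- /eqP<-] /orP[]/andP[/eqP<- /eqP<-]; tauto.
Qed.

(* The shortest closed stretch of the walk is a cycle. *)
Lemma nonbacktracking_cycle {V E : finType} (src tgt : E -> V)
    (f : nat -> E) (g : nat -> V) :
  (forall k, joins src tgt (f k) (g k) (g k.+1)) ->
  (forall k, f k.+1 <> f k) -> has_cycle src tgt.
Proof.
move=> fg_joins f_step.
pose closed m := (0 < m)%N && `[< exists i, g i = g (i + m)%N >].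
have closedE : exists m, closed m.
  pose h (k : 'I_#|V|.+1) := g k.
  have /injectivePn[i [j ij hij]] : ~~ injectiveb h.
    by apply/injectiveP => /leq_card; rewrite card_ord ltnn.
  wlog lt_ij : i j ij hij / (i < j)%N.
    move=> W; case: (ltngtP i j) => [|/(W j i)|/val_inj eij]; first exact: W.
      by apply=> //; rewrite eq_sym.
    by rewrite eij eqxx in ij.
  exists (j - i)%N; rewrite /closed subn_gt0 lt_ij /=; apply/asboolP.
  by exists i; rewrite subnKC ?(ltnW lt_ij).
case: (ex_minnP closedE) => m /andP[m_gt0 /asboolP[i gi]] m_min.
have g_inj a b : (a < m)%N -> (b < m)%N -> g (i + a)%N = g (i + b)%N -> a = b.
  wlog lt_ab : a b / (a < b)%N.
    by move=> W am bm gab; case: (ltngtP a b) => [/W|/W|//]; [exact|move/(_ bm am) ->].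
  move=> am bm gab; suff /m_min : closed (b - a)%N by lia.
  rewrite /closed subn_gt0 lt_ab; apply/asboolP; exists (i + a)%N.
  by rewrite gab; congr g; lia.
case: m m_gt0 gi m_min g_inj => // k _ gi _ g_inj.
exists k, (fun a : 'I_k.+1 => f (i + a)%N), (fun a : 'I_k.+1 => g (i + a)%N).
split; last split.
- move=> a b; wlog lt_ab : a b / (a < b)%N.
    move=> W fab; case: (ltngtP a b) => [/W|/W ba|/val_inj//]; first exact.
    exact/esym/ba.
  move=> fab; have Ja := fg_joins (i + a)%N; have Jb := fg_joins (i + b)%N.
  (* A repeated edge is crossed either in the same direction, so that the two starting vertices
     agree, or in the opposite one; then minimality makes the two steps consecutive, and the walk
     backtracks. *)
  rewrite -fab in Jb; case: (joins_eq_ends Ja Jb) => [[/g_inj gab _]|[_ gab]].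
    by apply/val_inj/gab.
  have ba : b = a.+1 :> nat.
    by apply/esym/g_inj; rewrite ?addnS //; have := ltn_ord b; lia.
  by case: (f_step (i + a)%N); rewrite fab ba addnS.
- by move=> a b /g_inj ab; apply/val_inj/ab.
- move=> a; have := fg_joins (i + a)%N.
  suff -> : g (i + a).+1 = g (i + ordS a)%N by [].
  rewrite /=; have [lt_ak|] := ltnP a.+1 k.+1; first by rewrite modn_small // addnS.
  move=> ka; have -> : nat_of_ord a = k by have := ltn_ord a; lia.
  by rewrite modnn addn0 gi addnS.
Qed.

(** Otherwise every edge of [F], crossed in either direction, could be left again through a
    different edge of [F]; continuing forever gives a walk without backtracking, hence a cycle. The
    vertex [u] is the leaf. *)
Lemma forest_leaf {V E : finType} (src tgt : E -> V) (F : {set E}) :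
  cake_forest src tgt -> F != finset.set0 ->
  exists e u w, [/\ e \in F, joins src tgt e u w, u <> w &
    forall f z, f \in F -> f <> e -> ~ joins src tgt f u z].
Proof.
move=> forest /finset.set0Pn[e0 Fe0]; apply: contrapT => noleaf.
pose dart := (E * V * V)%type.
pose ok (d : dart) := (d.1.1 \in F) && joins src tgt d.1.1 d.1.2 d.2.
have next_ex (d : dart) : exists d' : dart, ok d ->
    [/\ ok d', d'.1.2 = d.2 & d'.1.1 <> d.1.1].
  have [/andP[Fd Jd]|nok] := boolP (ok d); last by exists d.
  have Jd' : joins src tgt d.1.1 d.2 d.1.2 by move: Jd; rewrite /joins orbC.
  have dneq : d.2 <> d.1.2.
    move=> dd; apply: forest; exists 0%N, (fun=> d.1.1), (fun=> d.2).
    by split; [|split] => [i j _|i j _|i]; rewrite ?(ord1 i) ?(ord1 j) // {2}dd.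
  apply: contrapT => nex; apply: noleaf; exists d.1.1, d.2, d.1.2; split=> //.
  by move=> f z Ff fd Jf; apply: nex; exists (f, d.2, z); rewrite /ok /= Ff Jf.
pose next d := projT1 (cid (next_ex d)).
have nextP d : ok d -> [/\ ok (next d), (next d).1.2 = d.2 & (next d).1.1 <> d.1.1].
  by rewrite /next; case: cid.
pose d0 : dart := (e0, src e0, tgt e0).
pose ds k := iter k next d0.
have ds_ok k : ok (ds k).
  elim: k => [|k /nextP[]//]; by rewrite /ok /joins /= Fe0 !eqxx.
apply/forest/(@nonbacktracking_cycle _ _ _ _ (fun k => (ds k).1.1) (fun k => (ds k).1.2)).
  by move=> k; have [_ /= ->] := nextP _ (ds_ok k); have /andP[] := ds_ok k.
by move=> k; have [] := nextP _ (ds_ok k).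
Qed.

(** Induction on the number of edges: remove a leaf edge, root the rest, and hang the leaf [u] below
    its neighbour [w]. Injectivity of [c] says that a vertex has at most one parent edge; the rank
    [rk] makes the parent relation well-founded. *)
Lemma forest_rooting {V E : finType} (src tgt : E -> V) :
  cake_forest src tgt ->
  exists (c p : E -> V) (rk : V -> nat),
    [/\ forall e, joins src tgt e (c e) (p e), injective c &
        forall e, (rk (p e) < rk (c e))%N].
Proof.
move=> forest.
suff [c [p [rk [J cI lt_rk]]]] : exists (c p : E -> V) (rk : V -> nat),
    [/\ {in [set: E]%SET, forall e, joins src tgt e (c e) (p e)},
        {in [set: E]%SET &, injective c} &
        {in [set: E]%SET, forall e, (rk (p e) < rk (c e))%N}].
  exists c, p, rk; split=> [e|e f|e]; [exact: J|exact: cI|exact: lt_rk].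
have [k] := ubnP #|[set: E]%SET|.
elim: k [set: E]%SET => // k IHk F; rewrite ltnS => leFk.
have [->|/(forest_leaf forest)[e [u [w [Fe Je neq_uw leaf]]]]] := eqVneq F finset.set0.
  by exists src, src, (fun=> 0%N); split=> e; rewrite inE.
have [|c [p [rk [J cI lt_rk]]]] := IHk (F :\ e)%SET.
  by move: leFk; rewrite (cardsD1 e) Fe.
have inF f : f \in F -> f != e -> f \in (F :\ e)%SET by move=> Ff fe; rewrite !inE fe.
have ends f : f \in F -> f != e -> c f <> u /\ p f <> u.
  move=> Ff fe; have Jf := J f (inF f Ff fe).
  split=> fu; rewrite fu in Jf; apply: (leaf f) => //.
  - exact/eqP.
  - exact: Jf.
  - exact/eqP.
  - by move: Jf; rewrite /joins orbC; exact.
exists (fun f => if f == e then u else c f), (fun f => if f == e then w else p f),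
  (fun z => if z == u then (rk w).+1 else rk z); split.
- by move=> f Ff; case: eqVneq => [->//|fe]; exact/J/inF.
- move=> f f' Ff Ff'; case: eqVneq => [->|fe]; case: eqVneq => [->//|f'e].
  + by move=> /esym cf'; have [] := ends f' Ff' f'e.
  + by move=> cf; have [] := ends f Ff fe.
  + by apply: cI; exact: inF.
- move=> f Ff; case: (eqVneq f e) => [_|fe].
    by rewrite eqxx ifN //; apply/eqP => /esym.
  have [/eqP/negPf-> /eqP/negPf->] := ends f Ff fe; exact/lt_rk/inF.
Qed.
(** * Depth and ancestors in a rooted cake *)

(** Recursion down the tree from the roots: [step e] turns the value at the parent end of [e] into
    the value at its child end. It is run with fuel, and any fuel exceeding the rank gives the same
    value. *)
Lemma rooted_rec {V E : finType} (c p : E -> V) (rk : V -> nat) (X : Type)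
    (base : V -> X) (step : E -> X -> X) :
  injective c -> (forall e, (rk (p e) < rk (c e))%N) ->
  exists f : V -> X, (forall e, f (c e) = step e (f (p e))) /\
    (forall v, (forall e, c e <> v) -> f v = base v).
Proof.
move=> cI lt_rk.
pose F := fix F k v := if k is k'.+1 then
  if [pick e | c e == v] is Some e then step e (F k' (p e)) else base v else base v.
have F_fuel k k' v : (rk v < k)%N -> (rk v < k')%N -> F k v = F k' v.
  elim: k k' v => // k IHk [//|k'] v /= vk vk'.
  case: pickP => // e /eqP cev; congr step; apply: IHk.
    by apply: leq_trans (lt_rk e) _; rewrite cev.
  by apply: leq_trans (lt_rk e) _; rewrite cev.
exists (fun v => F (rk v).+1 v); split=> [e|v noparent].
  rewrite [LHS]/=; case: pickP => [e' /eqP/cI->|/(_ e)/eqP//].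
  by congr step; apply: F_fuel.
by rewrite /=; case: pickP => // e /eqP /noparent.
Qed.

(* [anc x t] stands for the ancestor of [x] at depth [t], and is meaningful only
   for [0 <= t <= depth x]. *)
Record ancestry {R : realType} {T : Type} (valid : set T) (depth : T -> R)
    (anc : T -> R -> T) : Prop := Ancestry {
  depth_ge0 : forall x, valid x -> 0 <= depth x;
  anc_valid : forall x t, valid x -> 0 <= t <= depth x -> valid (anc x t);
  depth_anc : forall x t, valid x -> 0 <= t <= depth x -> depth (anc x t) = t;
  anc_depth : forall x, valid x -> anc x (depth x) = x;
  anc_anc : forall x t t', valid x -> 0 <= t' <= t -> t <= depth x ->
    anc (anc x t) t' = anc x t';
  anc_split : forall x y, valid x -> valid y -> depth x = depth y -> 0 < depth x ->
    x <> y -> exists2 t0, t0 < depth x &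
      forall t, 0 <= t -> t0 < t <= depth x -> anc x t <> anc y t }.

Section AncestryDefs.
Context {R : realType} {T : Type} (valid : set T) (depth : T -> R)
  (anc : T -> R -> T).

Definition common_anc x y m :=
  [/\ 0 <= m, m <= depth x, m <= depth y & anc x m = anc y m].

(** [depth x + depth y - 2 * m] is the length of the route from [x] up to the common ancestor at
    depth [m] and down to [y]. Allowing any [m] avoids choosing the deepest common ancestor, and the
    strict inequality leaves room for limits. *)
Definition near_pt x y r :=
  exists2 m, common_anc x y m & depth x + depth y - 2 * m < r.

Definition anc_convex (X : set T) := X `<=` valid /\
  forall x y, X x -> X y -> exists2 m, common_anc x y m &
    forall t, m <= t -> (t <= depth x -> X (anc x t)) /\ (t <= depth y -> X (anc y t)).

End AncestryDefs.

(* Junk terms [PE e t] with [t <= 0] or [len e <= t] are not points of the cake. *)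
Definition cake_valid {R : realType} {V E : finType} (len : E -> R) :
    set (@cake_pt R V E) :=
  fun x => match x with PV _ => True | PE e t => 0 < t < len e end.

Lemma emb_in {R : realType} {V E : finType} (src tgt : E -> V) (len : E -> R) e t :
  0 < t < len e -> emb src tgt len e t = PE e t.
Proof. by move=> /andP[t0 t1]; rewrite /emb gt_eqF // lt_eqF. Qed.

Lemma emb_valid {R : realType} {V E : finType} (src tgt : E -> V) (len : E -> R) e t :
  0 <= t <= len e -> cake_valid len (emb src tgt len e t).
Proof.
rewrite /emb; case: eqVneq => // t0; case: eqVneq => // tl t_in.
by rewrite /= !lt_neqAle eq_sym t0 tl.
Qed.

Section RootedCake.
Context {R : realType} {V E : finType} (src tgt : E -> V) (len : E -> R).
Local Notation pt := (@cake_pt R V E).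
Local Notation valid := (@cake_valid R V E len).
Local Notation emb := (@emb R V E src tgt len).
Context (len_pos : forall e, 0 < len e).
Context (c p : E -> V) (rk : V -> nat).
Context (Jcp : forall e, joins src tgt e (c e) (p e)) (cI : injective c).
Context (lt_rk : forall e, (rk (p e) < rk (c e))%N).

(* The distance of the point with coordinate [t] on [e] from the parent end
   of [e]; as [height e] is an involution it also converts back. *)
Definition height e (t : R) := if p e == src e then t else len e - t.
Definition pemb e (u : R) := emb e (height e u).

Lemma heightK e : involutive (height e).
Proof. by move=> t; rewrite /height; case: (p e == src e) => //; rewrite subKr. Qed.

Lemma height_itv e t : (0 <= height e t <= len e) = (0 <= t <= len e).
Proof. by rewrite /height; case: ifP => // _; apply/andP/andP => -[]; lra. Qed.

Lemma height_oitv e t : (0 < height e t < len e) = (0 < t < len e).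
Proof. by rewrite /height; case: ifP => // _; apply/andP/andP => -[]; lra. Qed.

Lemma cp_neq e : c e <> p e.
Proof. by move=> cp; have := lt_rk e; rewrite cp ltnn. Qed.

Lemma ends_cp e : (p e = src e /\ c e = tgt e) \/ (p e = tgt e /\ c e = src e).
Proof. by case/orP: (Jcp e) => /andP[/eqP-> /eqP->]; tauto. Qed.

Lemma pemb_in e u : 0 < u < len e -> pemb e u = @PE R V E e (height e u).
Proof. by move=> u_in; rewrite /pemb emb_in ?height_oitv. Qed.

Lemma pemb0 e : pemb e 0 = @PV R V E (p e).
Proof.
rewrite /pemb /height /Defs.emb; have := @cp_neq e.
case: (ends_cp e) => -[-> ->]; first by rewrite !eqxx.
by move=> /eqP; rewrite eq_sym => /negPf->; rewrite subr0 eqxx gt_eqF.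
Qed.

Lemma pemb_len e : pemb e (len e) = @PV R V E (c e).
Proof.
rewrite /pemb /height /Defs.emb; have := @cp_neq e.
case: (ends_cp e) => -[-> ->]; first by rewrite !eqxx gt_eqF.
by move=> /eqP; rewrite eq_sym => /negPf->; rewrite subrr eqxx.
Qed.

Lemma pembP e u : 0 <= u <= len e ->
  [\/ u = 0, u = len e | 0 < u < len e].
Proof.
move=> /andP[u0 ul]; have [->|un0] := eqVneq u 0; first by constructor 1.
have [->|unl] := eqVneq u (len e); first by constructor 2.
by constructor 3; rewrite !lt_neqAle eq_sym un0 unl u0.
Qed.

Lemma pemb_valid e u : 0 <= u <= len e -> valid (pemb e u).
Proof.
move=> /pembP[->|->|u_in]; rewrite ?pemb0 ?pemb_len //.
by rewrite pemb_in //= height_oitv.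
Qed.

(** Depth and ancestor map of a vertex are built by one recursion, since the ancestor map switches
    from the parent's map to the edge [e] at the depth of the parent. *)
Lemma vertex_data_ex : exists d : V -> R * (R -> pt),
  (forall e, d (c e) = ((d (p e)).1 + len e,
     fun t => if t <= (d (p e)).1 then (d (p e)).2 t else pemb e (t - (d (p e)).1))) /\
  (forall v, (forall e, c e <> v) -> d v = (0, fun=> @PV R V E v)).
Proof.
exact: (rooted_rec (fun v => (0, fun=> @PV R V E v)) (fun e d => (d.1 + len e,
  fun t => if t <= d.1 then d.2 t else pemb e (t - d.1))) cI lt_rk).
Qed.

Definition vdata := projT1 (cid vertex_data_ex).

Lemma vdata_child e : vdata (c e) = ((vdata (p e)).1 + len e,
  fun t => if t <= (vdata (p e)).1 then (vdata (p e)).2 t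
           else pemb e (t - (vdata (p e)).1)).
Proof. by rewrite /vdata; case: cid => d [/= dc _]; exact: dc. Qed.

Lemma vdata_root v : (forall e, c e <> v) -> vdata v = (0, fun=> @PV R V E v).
Proof. by rewrite /vdata; case: cid => d [/= _ dr]; exact: dr. Qed.

Definition cake_depth (x : pt) : R := match x with
  | PV v => (vdata v).1
  | PE e t => (vdata (p e)).1 + height e t
  end.

Definition cake_anc (x : pt) (t : R) : pt := match x with
  | PV v => (vdata v).2 t
  | PE e _ => if t <= (vdata (p e)).1 then (vdata (p e)).2 t
              else pemb e (t - (vdata (p e)).1)
  end.

Local Notation pdepth e := (cake_depth (@PV R V E (p e))).
Local Notation panc e := (cake_anc (@PV R V E (p e))).

Lemma depth_pemb e u : 0 <= u <= len e -> cake_depth (pemb e u) = pdepth e + u.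
Proof.
move=> /pembP[->|->|u_in].
- by rewrite pemb0 addr0.
- by rewrite pemb_len /= vdata_child.
- by rewrite pemb_in //= heightK.
Qed.

Lemma anc_pemb e u t : 0 < u <= len e ->
  cake_anc (pemb e u) t = if t <= pdepth e then panc e t else pemb e (t - pdepth e).
Proof.
move=> /andP[u0 ul]; have /pembP[uE|->|u_in] : 0 <= u <= len e by rewrite ltW.
- by rewrite uE ltxx in u0.
- by rewrite pemb_len /= vdata_child.
- by rewrite pemb_in.
Qed.

Lemma depth_root v : (forall e, c e <> v) -> cake_depth (@PV R V E v) = 0.
Proof. by move=> rv; rewrite /= vdata_root. Qed.

Lemma anc_root v t : (forall e, c e <> v) -> cake_anc (@PV R V E v) t = @PV R V E v.
Proof. by move=> rv; rewrite /= vdata_root. Qed.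

(** * Ancestors of the points of the cake *)

(** Every valid point other than a root is [pemb e u] with [0 < u <= len e], the vertex [c e] being
    the case [u = len e]; thus vertices and interior points share one induction step. *)
Lemma cake_ind (Q : pt -> Prop) :
  (forall v, (forall e, c e <> v) -> Q (@PV R V E v)) ->
  (forall e u, 0 < u <= len e -> Q (@PV R V E (p e)) -> Q (pemb e u)) ->
  forall x, valid x -> Q x.
Proof.
move=> Qroot Qstep.
have QV v : Q (@PV R V E v).
  have [k] := ubnP (rk v); elim: k v => // k IHk v; rewrite ltnS => vk.
  have [[e ev]|nv] := pselect (exists e, c e = v); last first.
    by apply: Qroot => e ev; apply: nv; exists e.
  rewrite -ev -pemb_len; apply: Qstep; first by rewrite len_pos /=.
  by apply: IHk; apply: leq_trans vk; rewrite -ev.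
case=> // e t t_in; have := Qstep e (height e t).
rewrite pemb_in ?height_oitv // heightK; apply=> //.
by move: t_in; rewrite /= -height_oitv => /andP[-> /ltW].
Qed.

Lemma cake_ancestry : ancestry valid cake_depth cake_anc.
Proof.
have d_ge0 x : valid x -> 0 <= cake_depth x.
  move: x; apply: cake_ind => [v rv|e u /andP[u0 ul] IH]; first by rewrite depth_root.
  by rewrite depth_pemb; lra.
have pd_ge0 e : 0 <= pdepth e by exact: d_ge0.
have H12 x t : valid x -> 0 <= t <= cake_depth x ->
    valid (cake_anc x t) /\ cake_depth (cake_anc x t) = t.
  move=> xV; move: x xV t; apply: cake_ind => [v rv|e u u_in IH] t.
    by rewrite anc_root // depth_root // => /andP[t0 t1]; split=> //; lra.
  rewrite anc_pemb // depth_pemb; last lra.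
  move=> /andP[t0 tu].
  have [tp|tp] := leP t (pdepth e); first by apply: IH; rewrite t0.
  by split; [apply: pemb_valid; lra | rewrite depth_pemb; lra].
have H3 x : valid x -> cake_anc x (cake_depth x) = x.
  move: x; apply: cake_ind => [v rv|e u u_in IH]; first by rewrite anc_root.
  rewrite anc_pemb // depth_pemb; last lra.
  by rewrite ifF; [congr pemb; lra | lra].
split=> //.
- by move=> x t xV /(H12 _ _ xV)[].
- by move=> x t xV /(H12 _ _ xV)[].
- move=> x t t' xV; move: x xV t t'; apply: cake_ind => [v rv|e u u_in IH] t t'.
    by rewrite !anc_root.
  rewrite depth_pemb; last lra.
  move=> /andP[t'0 t't] tu.
  rewrite [cake_anc (pemb e u) t]anc_pemb //.
  have [tp|tp] := leP t (pdepth e).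
    rewrite IH ?t'0 // anc_pemb // ifT //; exact: le_trans tp.
  by rewrite !anc_pemb //; lra.
- move=> x y xV yV; move: x xV y yV; apply: cake_ind => [v rv|e u u_in _].
    by move=> y _ _; rewrite depth_root // ltxx.
  apply: cake_ind => [v rv|e' u' u'_in _].
    by move=> ->; rewrite depth_root // ltxx.
  rewrite !depth_pemb; [|lra|lra].
  move=> duu' _ xy.
  (* Past the deeper of the two parent ends, both ancestors lie on the edges [e] and [e']
     themselves. If they met at an interior point, the edges would agree, and by equality of depths
     the two points would coincide. *)
  exists (Num.max (pdepth e) (pdepth e')); first by rewrite gt_max; lra.
  move=> t t0; rewrite gt_max => /andP[/andP[pt p't] tu].
  rewrite !anc_pemb // !ifF; [|lra|lra].
  move: tu; rewrite le_eqVlt => /orP[/eqP tE|tu]; last first.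
    rewrite !pemb_in; [|lra|lra].
    move=> [ee' _]; apply: xy; rewrite -ee' in duu' *; congr pemb; lra.
  have -> : t - pdepth e = u by lra.
  by have -> : t - pdepth e' = u' by lra.
Qed.

Lemma pemb_anc e u u' : 0 <= u <= u' -> u' <= len e ->
  cake_anc (pemb e u') (pdepth e + u) = pemb e u.
Proof.
move=> uu' u'l; have [u'E|u'0] := eqVneq u' 0.
  have -> : u = 0 by lra.
  rewrite u'E addr0 pemb0; exact: (anc_depth cake_ancestry).
have u'p : 0 < u' by rewrite lt_neqAle eq_sym u'0; lra.
rewrite anc_pemb ?u'p // gerDl; have [u0|u0] := leP u 0.
  have -> : u = 0 by lra.
  rewrite addr0 pemb0; exact: (anc_depth cake_ancestry).
by congr pemb; lra.
Qed.

(** * Walks and common ancestors *)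

Lemma seg_setE e u u' t : 0 <= u <= len e -> 0 <= u' <= len e ->
  Num.min u u' <= t <= Num.max u u' ->
  seg_set src tgt len (e, height e u, height e u') (pemb e t).
Proof.
move=> u_in u'_in; rewrite ge_min le_max => t_in.
exists (height e t) => //=; rewrite in_itv /= ge_min le_max /height.
by case: (p e == src e) => //; lra.
Qed.

Lemma seg_setP e u u' z : seg_set src tgt len (e, height e u, height e u') z ->
  exists2 t, Num.min u u' <= t <= Num.max u u' & z = pemb e t.
Proof.
case=> t /=; rewrite in_itv /= => t_in <-; exists (height e t).
  move: t_in; rewrite !ge_min !le_max /height.
  by case: (p e == src e) => //; lra.
by rewrite /pemb heightK.
Qed.

Lemma seg_len_height e u u' : seg_len (e, height e u, height e u') = `|u' - u|.
Proof.
rewrite /seg_len /height /=; case: (p e == src e) => //.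
by rewrite distrC; congr `|_|; lra.
Qed.

Lemma walk_cat x y z w w' : walk src tgt len x y w -> walk src tgt len y z w' ->
  walk src tgt len x z (w ++ w').
Proof. by elim: w x => /= [x -> //|s w IHw x [? [? /IHw{}IHw]] /IHw]. Qed.

Definition seg_flip (s : @seg R E) : @seg R E := (s.1.1, s.2, s.1.2).

Lemma seg_flip_set s : seg_set src tgt len (seg_flip s) = seg_set src tgt len s.
Proof. by rewrite /seg_set /= minC maxC. Qed.

Lemma walk_rev x y w : walk src tgt len x y w ->
  walk src tgt len y x (rev (map seg_flip w)).
Proof.
elim: w x => /= [x ->//|s w IHw x [[s1 s2] [sx /IHw ws]]].
by rewrite rev_cons -cats1; apply: walk_cat ws _.
Qed.

Lemma walk_rev_len (w : seq (@seg R E)) : walk_len (rev (map seg_flip w)) = walk_len w.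
Proof.
rewrite /walk_len big_rev big_map; apply: eq_bigr => s _.
by rewrite /seg_len /= distrC.
Qed.

Lemma walk_up x t : valid x -> 0 <= t <= cake_depth x ->
  exists w, [/\ walk src tgt len x (cake_anc x t) w, walk_len w = cake_depth x - t &
    forall s z, s \in w -> seg_set src tgt len s z ->
      exists2 t', t <= t' <= cake_depth x & z = cake_anc x t'].
Proof.
move=> xV; move: x xV t; apply: cake_ind => [v rv|e u u_in IH] t.
  rewrite depth_root // anc_root // => t0; exists [::]; split=> //.
  by rewrite /walk_len big_nil; lra.
have u_in' : 0 <= u <= len e by lra.
rewrite depth_pemb // => t_in.
have seg_anc q z : 0 <= q <= u -> seg_set src tgt len (e, height e u, height e q) z ->
    exists2 t', pdepth e + q <= t' <= pdepth e + u & z = cake_anc (pemb e u) t'.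
  move=> q_in /seg_setP[t']; rewrite ge_min le_max => t'_in ->.
  by exists (pdepth e + t'); [lra|rewrite pemb_anc //; lra].
have seg_ok_u q : 0 <= q <= u -> seg_ok len (e, height e u, height e q).
  by move=> q_in; rewrite /seg_ok /= !height_itv; lra.
have [tp|tp] := leP t (pdepth e).
  have [|w [ww wl wP]] := IH t; first lra.
  have u0 : 0 <= (0 : R) <= u by lra.
  exists ((e, height e u, height e 0) :: w); split.
  - split; [exact: seg_ok_u|split=> //].
    rewrite /= -/(pemb e 0) pemb0 anc_pemb // tp; exact: ww.
  - rewrite /walk_len big_cons -/(walk_len w) wl seg_len_height sub0r normrN.
    by rewrite ger0_norm; lra.
  - move=> s z; rewrite inE => /orP[/eqP->|sw sz].
      case/(seg_anc _ _ u0) => t' t'_in ->.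
      by exists t' => //; lra.
    have [t' t'_in ->] := wP s z sw sz; exists t'; first lra.
    by rewrite anc_pemb // ifT //; lra.
have q_in : 0 <= t - pdepth e <= u by lra.
exists [:: (e, height e u, height e (t - pdepth e))]; split.
- split; [exact: seg_ok_u|split=> //].
  by rewrite /= -/(pemb e _) anc_pemb // ifF //; lra.
- rewrite /walk_len big_seq1 seg_len_height distrC ger0_norm; lra.
- move=> s z; rewrite inE => /eqP-> /(seg_anc _ _ q_in)[t' t'_in ->].
  by exists t' => //; lra.
Qed.

Lemma walk_valid x y w : valid x -> walk src tgt len x y w -> valid y.
Proof.
elim: w x => [x xV <-//|s w IHw x _ [[_ s2] [_ ws]]].
by apply: IHw ws; apply: emb_valid.
Qed.

(** Induction on the walk. Its first segment runs along a single edge, so one end of it is an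
    ancestor of the other, and the common ancestor found for the rest of the walk is either kept or
    replaced by [x]. The length bound serves the comparison of distances, the last clause that of
    connectedness. *)
Lemma walk_common_anc (X : set pt) x y w : valid x -> X x ->
  walk src tgt len x y w -> (forall s, s \in w -> seg_set src tgt len s `<=` X) ->
  exists m, [/\ common_anc cake_depth cake_anc x y m,
    cake_depth x + cake_depth y - 2 * m <= walk_len w & forall t, m <= t ->
      (t <= cake_depth x -> X (cake_anc x t)) /\ (t <= cake_depth y -> X (cake_anc y t))].
Proof.
have HA := cake_ancestry.
elim: w x => [|[[e a] b] w IHw] x xV Xx /=.
  move=> <- _; exists (cake_depth x); have := depth_ge0 HA xV => dx0.
  split=> //; first by rewrite /walk_len big_nil; lra.
  move=> t xt; have tE t' : t' <= cake_depth x -> t' = cake_depth x -> X (cake_anc x t').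
    by move=> _ ->; rewrite (anc_depth HA).
  by split=> tx; apply: tE => //; lra.
rewrite /seg_ok /= => -[[a_in b_in] [xE ww]] wX.
set u := height e a; set u' := height e b.
have u_in : 0 <= u <= len e by rewrite height_itv.
have u'_in : 0 <= u' <= len e by rewrite height_itv.
have aE : a = height e u by rewrite heightK.
have bE : b = height e u' by rewrite heightK.
have xE' : x = pemb e u by rewrite -xE aE.
have segX t : Num.min u u' <= t <= Num.max u u' -> X (pemb e t).
  move=> t_in; apply: (wX (e, a, b)); first by rewrite inE eqxx.
  by rewrite aE bE; apply: seg_setE.
set x' := emb e b; have x'E : x' = pemb e u' by rewrite /x' bE.
have Xx' : X x' by rewrite x'E; apply: segX; rewrite ge_min le_max lexx !orbT.
have x'V : valid x' by rewrite x'E; apply: pemb_valid.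
have [|m [[m0 mx' my ancm] lem mX]] := IHw x' x'V Xx' ww.
  by move=> s sw; apply: wX; rewrite inE sw orbT.
have lw : walk_len ((e, a, b) :: w) = `|u' - u| + walk_len w.
  by rewrite /walk_len big_cons aE bE seg_len_height.
have dx : cake_depth x = pdepth e + u by rewrite xE' depth_pemb.
have dx' : cake_depth x' = pdepth e + u' by rewrite x'E depth_pemb.
have pd0 : 0 <= pdepth e by exact: (depth_ge0 HA).
have ancy t : 0 <= t <= m -> cake_anc y t = cake_anc x' t.
  move=> t_in; have yV : valid y.
    exact: walk_valid x'V ww.
  by rewrite -(anc_anc HA yV t_in my) -ancm (anc_anc HA).
have [uu'|u'u] := leP u u'.
  have xx' : cake_anc x' (cake_depth x) = x by rewrite dx x'E xE' pemb_anc //; lra.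
  have ancx' t : 0 <= t <= cake_depth x -> cake_anc x t = cake_anc x' t.
    by move=> t_in; rewrite -[in LHS]xx' (anc_anc HA) //; lra.
  have nn : `|u' - u| = u' - u by rewrite ger0_norm; lra.
  have [mx|mx] := leP m (cake_depth x).
    exists m; split; [split=> //|lra|].
      by rewrite ancx' //; lra.
    move=> t mt; split=> tx; last by apply: (mX t mt).2.
    by rewrite ancx'; [apply: (mX t mt).1; lra|lra].
  (* Here the common ancestor of [x'] and [y] is strictly deeper than [x], and [x] itself is an
     ancestor of [y]. *)
  exists (cake_depth x); split; [split=> //; [lra|lra|] | lra |].
    by rewrite ancy ?xx' ?(anc_depth HA) //; lra.
  move=> t xt; split=> ty.
    have -> : t = cake_depth x by lra.
    by rewrite (anc_depth HA).
  have [mt|tm] := leP m t; first by apply: (mX t mt).2.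
  rewrite ancy; last lra.
  have tE : t = pdepth e + (t - pdepth e) by lra.
  rewrite x'E {}tE pemb_anc; [|lra|lra].
  by apply: segX; rewrite ge_min le_max; lra.
have xx' : cake_anc x (cake_depth x') = x' by rewrite dx' x'E xE' pemb_anc //; lra.
have nn : `|u' - u| = u - u' by rewrite ler0_norm; lra.
have ancx' t : 0 <= t <= cake_depth x' -> cake_anc x t = cake_anc x' t.
  by move=> t_in; rewrite -[in RHS]xx' (anc_anc HA) //; lra.
exists m; split; [split=> //; [lra|]|lra|].
  by rewrite ancx' //; lra.
move=> t mt; split=> tx; last by apply: (mX t mt).2.
have [tx'|x't] := leP t (cake_depth x').
  by rewrite ancx'; [apply: (mX t mt).1|lra].
have tE : t = pdepth e + (t - pdepth e) by lra.
rewrite xE' {}tE pemb_anc; [|lra|lra].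
by apply: segX; rewrite ge_min le_max; lra.
Qed.
End RootedCake.

(** * Conflicting convex sets *)

Section Ancestry.
Context {R : realType} {T : Type} {valid : set T} {depth : T -> R}
  {anc : T -> R -> T} (HA : ancestry valid depth anc).
Local Notation common := (common_anc depth anc).
Local Notation near := (near_pt depth anc).
Local Notation convex := (anc_convex valid depth anc).
Implicit Types (x y z : T) (m r s t : R).

Lemma common_refl x : valid x -> common x x (depth x).
Proof. by move=> xV; split=> //; apply: (depth_ge0 HA). Qed.

Lemma common_sym x y m : common x y m -> common y x m.
Proof. by case. Qed.

Lemma common_le x y m t : valid x -> valid y -> common x y m -> 0 <= t <= m ->
  common x y t.
Proof.
move=> xV yV [m0 mx my xy] /andP[t0 tm]; split=> //; try exact: le_trans tm _.
by rewrite -(anc_anc HA xV _ mx) ?t0 // xy (anc_anc HA yV _ my) ?t0.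
Qed.

Lemma common_trans x y z m : common x y m -> common y z m -> common x z m.
Proof. by move=> [m0 mx my xy] [_ _ mz yz]; split=> //; rewrite xy. Qed.

Lemma common_ancr x m : valid x -> 0 <= m <= depth x -> common (anc x m) x m.
Proof.
move=> xV m_in; have /andP[m0 mx] := m_in.
by split; rewrite ?(depth_anc HA) // (anc_anc HA) // m0 lexx.
Qed.

Lemma near_sym x y r : near x y r -> near y x r.
Proof. by case=> m /common_sym xy lt_r; exists m => //; rewrite (addrC (depth y)). Qed.

Lemma near_refl x r : valid x -> 0 < r -> near x x r.
Proof. by move=> xV r0; exists (depth x); [exact: common_refl|lra]. Qed.

Lemma near_trans x y z r r' : valid x -> valid y -> valid z ->
  near x y r -> near y z r' -> near x z (r + r').
Proof.
move=> xV yV zV [m xy lt_r] [m' yz lt_r'].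
have [[m0 mx my _] [m'0 m'y m'z _]] := (xy, yz).
have [mm'|m'm] := leP m m'; [exists m|exists m']; try lra.
  by apply: common_trans xy _; apply: common_le yz _; rewrite ?m0.
by apply: common_trans yz; apply: common_le xy _; rewrite ?m'0 ?ltW.
Qed.

Definition conflict s (X Y : set T) := exists x y, [/\ X x, Y y & near x y s].

Lemma conflict_sym s X Y : conflict s X Y -> conflict s Y X.
Proof. by case=> x [y [Xx Yy /near_sym]]; exists y, x. Qed.

Lemma convex_truncate X x x0 M : convex X -> X x -> X x0 -> depth x0 <= M ->
  X (anc x (Num.min (depth x) M)).
Proof.
move=> [_ cX] Xx Xx0 x0M; have [m [m0 mx mx0 _] mX] := cX x x0 Xx Xx0.
by apply: (mX _ _).1; rewrite ?ge_min ?le_min ?lexx // mx; lra.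
Qed.

(** Lifting points deeper than [M] to depth [M] keeps them in their convex sets, which have points
    at depth at most [M], and does not increase their distance. If the common ancestor has depth at
    least [M], the lifted points coincide and [0 < s] applies. *)
Lemma conflict_truncate s X Y x0 y0 M : convex X -> convex Y -> 0 < s ->
  conflict s X Y -> X x0 -> Y y0 -> depth x0 <= M -> depth y0 <= M ->
  exists x y, [/\ X x, Y y, depth x <= M, depth y <= M & near x y s].
Proof.
move=> cX cY s0 [x [y [Xx Yy [m xy lt_s]]]] Xx0 Yy0 x0M y0M.
have [xV yV] : valid x /\ valid y by split; [exact: cX.1|exact: cY.1].
have dx0 := depth_ge0 HA (cX.1 _ Xx0); have [m0 mx my _] := xy.
set tx := Num.min (depth x) M; set ty := Num.min (depth y) M.
have [txx txM] : tx <= depth x /\ tx <= M by rewrite !ge_min !lexx orbT.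
have [tyy tyM] : ty <= depth y /\ ty <= M by rewrite !ge_min !lexx orbT.
set mu := Num.min m M.
have [mum muM] : mu <= m /\ mu <= M by rewrite !ge_min !lexx orbT.
have mu0 : 0 <= mu by rewrite le_min m0; lra.
have mutx : mu <= tx by rewrite le_min muM andbT; lra.
have muty : mu <= ty by rewrite le_min muM andbT; lra.
have anc_mu z t : valid z -> mu <= t <= depth z -> common (anc z t) z mu.
  move=> zV t_in; apply: (@common_le _ _ t) => //; last lra.
    by apply: (anc_valid HA) => //; lra.
  by apply: common_ancr => //; lra.
exists (anc x tx), (anc y ty); split.
- exact: convex_truncate Xx0 x0M.
- exact: convex_truncate Yy0 y0M.
- by rewrite (depth_anc HA) //; lra.
- by rewrite (depth_anc HA) //; lra.
- exists mu.
    apply: (@common_trans _ x); first by apply: anc_mu => //; lra.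
    apply: (@common_trans _ y); first by apply: (common_le _ _ xy) => //; lra.
    by apply/common_sym/anc_mu => //; lra.
  rewrite !(depth_anc HA) //; [|lra|lra].
  have : mu = m \/ mu = M by rewrite /mu minEle; case: ifP; auto.
  by case=> ->; lra.
Qed.

(* [H] is the depth of the top of [P], which need not belong to [P]: hence the [eps]. *)
Lemma deepest_simplicial s H P Q1 Q2 : 0 < s -> 0 <= H ->
  convex P -> convex Q1 -> convex Q2 -> (forall x, P x -> H <= depth x) ->
  (forall X, X \in [:: P; Q1; Q2] ->
     forall eps, 0 < eps -> exists2 x, X x & depth x < H + eps) ->
  conflict s P Q1 -> conflict s P Q2 -> conflict s Q1 Q2.
Proof.
move=> s0 H0 cP cQ1 cQ2 PH Htop C1 C2.
have tighten Q : conflict s P Q -> exists2 s', 0 < s' < s & conflict s' P Q.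
  case=> x [y [Px Qy [m xy lt_s]]].
  exists (Num.max (s / 2) ((depth x + depth y - 2 * m + s) / 2)).
    by rewrite lt_max gt_max; lra.
  by exists x, y; split=> //; exists m => //; rewrite lt_max; apply/orP; right; lra.
have widen a b Q : a <= b -> conflict a P Q -> conflict b P Q.
  move=> ab [x [y [Px Qy [m xy lt_a]]]].
  by exists x, y; split=> //; exists m => //; lra.
have [s1 s1_in {}C1] := tighten _ C1; have [s2 s2_in {}C2] := tighten _ C2.
set s' := Num.max s1 s2.
have [s1s' s2s'] : s1 <= s' /\ s2 <= s' by rewrite /s' !le_max !lexx orbT.
have s's : s' < s by rewrite gt_max; lra.
pose eta := (s - s') / 2; have eta0 : 0 < eta by rewrite /eta; lra.
have [x0 Px0 x0H] := Htop P (mem_head _ _) eta eta0.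
have top Q : Q \in [:: P; Q1; Q2] -> convex Q -> conflict s' P Q ->
    exists x q m, [/\ P x, Q q, depth x <= H + eta, depth q <= H + eta &
      common x q m /\ depth x + depth q - 2 * m < s'].
  move=> QQ cQ CQ; have [q0 Qq0 q0H] := Htop Q QQ eta eta0.
  have s'0 : 0 < s' by lra.
  have [x [q [Px Qq xH qH [m]]]] :=
    conflict_truncate cP cQ s'0 CQ Px0 Qq0 (ltW x0H) (ltW q0H).
  by exists x, q, m.
have [|x1 [q1 [m1 [Px1 Qq1 x1H q1H [xq1 lt1]]]]] := top Q1 _ cQ1 (widen _ _ _ s1s' C1).
  by rewrite !inE eqxx orbT.
have [|x2 [q2 [m2 [Px2 Qq2 x2H q2H [xq2 lt2]]]]] := top Q2 _ cQ2 (widen _ _ _ s2s' C2).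
  by rewrite !inE eqxx !orbT.
have [x1V x2V] : valid x1 /\ valid x2 by split; apply: cP.1.
have [q1V q2V] : valid q1 /\ valid q2 by split; [apply: cQ1.1|apply: cQ2.1].
have [m0 x1x2 m0P] := cP.2 _ _ Px1 Px2.
have [m00 m0x1 m0x2 _] := x1x2.
(* The upward paths of [x1] and [x2] meet inside [P], hence not above its top. *)
have Hm0 : H <= m0.
  by rewrite -(depth_anc HA x1V (t := m0)) ?m00 //; apply/PH/(m0P _ _).1.
have [[m10 m1x m1q _] [m20 m2x m2q _]] := (xq1, xq2).
have [Hx1 Hx2] : H <= depth x1 /\ H <= depth x2 by split; apply: PH.
(* Up to depth [mu] the points [q1], [x1], [x2], [q2] have the same ancestors. If [mu = H], the
   route from [q1] to [q2] has length at most [2 * eta]; if [mu = m1], replacing [x1] by [q2] costs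
   at most [eta], since [x1] is not above the top of [P]; likewise for [m2]. *)
set mu := Num.min H (Num.min m1 m2).
have [muH mum1 mum2] : [/\ mu <= H, mu <= m1 & mu <= m2].
  by rewrite /mu !ge_min !lexx !orbT.
have mu0 : 0 <= mu by rewrite !le_min H0 m10.
exists q1, q2; split=> //; exists mu.
  apply: (@common_trans _ x1).
    by apply/common_sym; apply: (common_le _ _ xq1) => //; lra.
  apply: (@common_trans _ x2); first by apply: (common_le _ _ x1x2) => //; lra.
  by apply: (common_le _ _ xq2) => //; lra.
have : [\/ mu = H, mu = m1 | mu = m2].
  rewrite /mu minEle; case: ifP => _; first by constructor 1.
  by rewrite minEle; case: ifP => _; [constructor 2|constructor 3].
have etaE : eta * 2 = s - s' by rewrite /eta; lra.
by case=> ->; lra.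
Qed.

End Ancestry.

(** * Greedy choice of one piece per agent *)

(** Induction on [#|S|]: an available pair [(i, j)] of largest [h] settles [i]. By the second
    hypothesis at most one index of each remaining [J i'] conflicts with it; deleting that index
    lowers [#|J i'|] by at most one, while [#|S|] drops by one. *)
Lemma simplicial_selection {R : realType} {I : finType} {n : nat}
    (C : I -> 'I_n -> I -> 'I_n -> Prop) (h : I -> 'I_n -> R) (j0 : 'I_n) :
  (forall i j i' j', C i j i' j' -> C i' j' i j) ->
  (forall i j i' j1 j2, h i' j1 <= h i j -> h i' j2 <= h i j ->
     C i j i' j1 -> C i j i' j2 -> j1 = j2) ->
  forall (S : {set I}) (J : I -> {set 'I_n}),
  (forall i, i \in S -> (#|S| <= #|J i|)%N) ->
  exists f : I -> 'I_n, (forall i, i \in S -> f i \in J i) /\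
    forall i i', i \in S -> i' \in S -> i != i' -> ~ C i (f i) i' (f i').
Proof.
move=> Csym Csimp S; have [k] := ubnP #|S|.
elim: k S => // k IHk S; rewrite ltnS => leSk J SJ.
have [->|/finset.set0Pn[i0 Si0]] := eqVneq S finset.set0.
  by exists (fun=> j0); split=> i; rewrite inE.
have /card_gt0P[j1 Jj1] : (0 < #|J i0|)%N.
  by apply: leq_trans (SJ _ Si0); apply/card_gt0P; exists i0.
pose A := [pred ij : I * 'I_n | (ij.1 \in S) && (ij.2 \in J ij.1)].
have A0 : A (i0, j1) by rewrite /A /= Si0.
case: (@arg_maxP _ _ _ (i0, j1) A (fun ij => h ij.1 ij.2) A0).
move=> [i j] /andP[/= Si Jj] ij_max.
pose J' i' := [set j' in J i' | `[< ~ C i j i' j' >]]%SET.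
have [||f [fJ fC]] := IHk (S :\ i)%SET _ J'.
- by move: leSk; rewrite (cardsD1 i) Si.
- move=> i'; rewrite !inE => /andP[_ Si'].
  have -> : #|(S :\ i)%SET| = #|S|.-1 by rewrite (cardsD1 i S) Si.
  have : (#|[set j' in J i' | `[< C i j i' j' >]]%SET| <= 1)%N.
    apply/card_le1_eqP => j2 j3; rewrite !inE.
    move=> /andP[J2 /asboolP C2] /andP[J3 /asboolP C3].
    apply: (Csimp i j i' _ _ _ _ C3 C2); last by apply: (ij_max (i', j2)); rewrite /= Si'.
    by apply: (ij_max (i', j3)); rewrite /= Si'.
  have := SJ _ Si'; rewrite -(finset.cardsID [set j' | `[< C i j i' j' >]]%SET (J i')).
  have -> : (J i' :\: [set j' | `[< C i j i' j' >]])%SET = J' i'.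
    by apply/finset.setP => j'; rewrite !inE asbool_neg andbC.
  have -> : (J i' :&: [set j' | `[< C i j i' j' >]])%SET
          = [set j' in J i' | `[< C i j i' j' >]]%SET.
    by apply/finset.setP => j'; rewrite !inE.
  move=> le_S le_1; rewrite -subn1 leq_subLR; apply: leq_trans le_S _.
  by rewrite leq_add2r.
exists (fun i' => if i' == i then j else f i'); split.
  move=> i' Si'; have [->//|ii'] := eqVneq i' i.
  by have := fJ i'; rewrite !inE ii' Si' => /(_ isT)/andP[].
have Cf i' : i' \in S -> i' != i -> ~ C i j i' (f i').
  move=> Si' i'i; have := fJ i'; rewrite !inE i'i Si' => /(_ isT)/andP[_].
  by move=> /asboolP.
move=> a b Sa Sb ab; have [ai|ai] := eqVneq a i; have [bi|bi] := eqVneq b i.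
- by rewrite ai bi eqxx in ab.
- by rewrite ai; apply: Cf.
- by rewrite bi => /Csym; apply: Cf.
- by apply: fC; rewrite // !inE ?ai ?bi.
Qed.

(** * Limits of convex sets *)

Section Limits.
Context {R : realType} {T : Type} {valid : set T} {depth : T -> R}
  {anc : T -> R -> T} (HA : ancestry valid depth anc).
Local Notation common := (common_anc depth anc).
Local Notation near := (near_pt depth anc).
Local Notation convex := (anc_convex valid depth anc).

(** The supremum [m] of the common depths is attained: if the ancestors at depth [m > 0] differed,
    [anc_split] would keep them different at all depths [t] with [t0 < t <= m], against the choice
    of [m]. *)
Lemma meet_ex x y : valid x -> valid y -> common x y 0 ->
  exists2 m, common x y m &
    forall t, m < t -> t <= depth x -> t <= depth y -> anc x t <> anc y t.
Proof.
move=> xV yV c0; pose A : set R := [set t | common x y t].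
have A0 : A !=set0 by exists 0.
have ubx : ubound A (depth x) by move=> t [].
have uby : ubound A (depth y) by move=> t [].
have hsA : has_sup A by split=> //; exists (depth x).
pose m := sup A; have Am t : A t -> t <= m by exact: (ub_le_sup hsA.2).
have m0 : 0 <= m by exact: Am.
have mx : m <= depth x by exact: ge_sup.
have my : m <= depth y by exact: ge_sup.
exists m; last first.
  move=> t mt tx ty xy; have /Am : A t by split=> //; lra.
  by rewrite leNgt mt.
have [->//|mn0] := eqVneq m 0.
have mp : 0 < m by rewrite lt_neqAle eq_sym mn0.
split=> //; apply: contrapT => anc_neq.
have [||||t0 t0m t0P] := anc_split HA _ _ _ _ anc_neq.
- by apply: (anc_valid HA) => //; lra.
- by apply: (anc_valid HA) => //; lra.
- by rewrite !(depth_anc HA) //; lra.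
- by rewrite (depth_anc HA) //; lra.
rewrite (depth_anc HA) in t0m t0P; [|exact: xV|lra].
have [|t At] := sup_adherent (_ : 0 < m - t0) hsA; first lra.
rewrite -/m => t0t; have tm := Am t At; have [tge0 _ _ xyt] := At.
by apply: (t0P t) => //; [lra|rewrite !(anc_anc HA) //; lra].
Qed.

Lemma near_lt x y r : near x y r -> exists2 r', r' < r & near x y r'.
Proof.
case=> m xy lt_r; exists ((depth x + depth y - 2 * m + r) / 2); first lra.
by exists m => //; lra.
Qed.

(** Limit along [F]: the points all of whose neighbourhoods meet [P k] for [F]-many [k]. Taken along
    an ultrafilter, it spares the choice of subsequences. *)
Definition limset (F : set_system nat) (P : nat -> set T) : set T :=
  [set x | valid x /\ forall eps, 0 < eps ->
     F [set k | exists2 y, P k y & near x y eps]].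

Context {F : set_system nat} {FF : ProperFilter F}.

(** Let [m] be the depth of the deepest common ancestor of [x] and [y], and approximate both points
    by [x'] and [y'] in [P k]. An ancestor of [x] strictly deeper than [m] lies in [P k] or is close
    to [x'] or [y']; the one at depth [m] follows as limit sets are closed. *)
Lemma limset_convex P : (forall k, convex (P k)) -> convex (limset F P).
Proof.
move=> cP; split=> [x []//|].
have half x y m : limset F P x -> limset F P y -> common x y m ->
    (forall t, m < t -> t <= depth x -> t <= depth y -> anc x t <> anc y t) ->
    forall t, m <= t -> t <= depth x -> limset F P (anc x t).
  move=> [xV xP] [yV yP] xym sep.
  have [m0 mx my _] := xym.
  have gt_m t : m < t -> t <= depth x -> limset F P (anc x t).
    move=> mt tx; have t_in : 0 <= t <= depth x by lra.
    have zV := anc_valid HA xV t_in.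
    split=> // eps eps0; apply: filterS (filterI (xP _ eps0) (yP _ eps0)).
    move=> k [[x' Px' [a xx' lt_a]] [y' Py' [b yy' lt_b]]].
    have [x'V y'V] : valid x' /\ valid y' by split; apply: (cP k).1.
    have [[a0 ax ax' _] [b0 byy by' _]] := (xx', yy').
    have [ta|at_] := leP t a; last first.
      exists x' => //; exists a; last by rewrite (depth_anc HA) //; lra.
      apply: common_trans xx'; apply: (common_le HA (m := t)) => //; last lra.
      apply: (common_ancr HA) => //; lra.
    have [_ _ tx' ancx'] := common_le HA xV x'V xx' (t := t) ltac:(lra).
    have [m' x'y' mP] := (cP k).2 _ _ Px' Py'.
    have [_ m'x' m'y' _] := x'y'.
    have [m't|tm'] := leP m' t.
      exists (anc x t); first by rewrite ancx'; apply: (mP t m't).1.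
      exact: (near_refl HA).
    have [_ _ ty' ancy'] := common_le HA x'V y'V x'y' (t := t) ltac:(lra).
    (* Now [x'] and [y'] share the ancestor at depth [t], but [x] and [y] do not; hence [b < t], and
       [y'] is close to that ancestor. *)
    exists y' => //; exists t.
      by rewrite ancx' ancy'; apply: (common_ancr HA) => //; lra.
    rewrite (depth_anc HA) //; have [tb|bt] := leP t b; last lra.
    have [_ _ _ ancy] := common_le HA yV y'V yy' (t := t) ltac:(lra).
    by case: (sep t mt tx ltac:(lra)); rewrite ancx' ancy' ancy.
  move=> t mt tx; have [tm|mt'] := leP t m; last exact: gt_m.
  have -> : t = m by lra.
  have [xm|mx'] := leP (depth x) m.
    have -> : m = depth x by lra.
    by rewrite (anc_depth HA) //; exact: (conj xV xP).
  have mV := anc_valid HA xV (t := m) ltac:(lra).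
  split=> // eps eps0.
  (* A depth slightly larger than [m], to which the previous case applies; the ancestor there is
     within [eps / 4] of the one at depth [m]. *)
  pose t' := Num.min (depth x) (m + eps / 4).
  have t'_in : m < t' /\ t' <= m + eps / 4 /\ t' <= depth x.
    by rewrite lt_min !ge_min !lexx orbT; split; [lra|].
  have [t'V t'P] := gt_m t' ltac:(lra) ltac:(lra).
  have e2 : 0 < eps / 2 by lra.
  apply: filterS (t'P _ e2) => k [z Pz t'z]; exists z => //.
  have -> : eps = eps / 2 + eps / 2 by lra.
  apply: (near_trans HA) t'z => //; first exact: (cP k).1.
  exists m; last by rewrite !(depth_anc HA) //; lra.
  apply: (@common_trans _ _ _ _ _ x); first by apply: (common_ancr HA) => //; lra.
  apply: common_sym; apply: (common_le HA (m := t')) => //; last lra.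
  by apply: (common_ancr HA) => //; lra.
move=> x y Lx Ly; have [[xV xP] [yV yP]] := (Lx, Ly).
have [m xym sep] : exists2 m, common x y m &
    forall t, m < t -> t <= depth x -> t <= depth y -> anc x t <> anc y t.
  apply: meet_ex => //.
  have [k [[x' Px' [a xx' _]] [y' Py' [b yy' _]]]] :=
    filter_ex (filterI (xP 1 ltr01) (yP 1 ltr01)).
  have [x'V y'V] : valid x' /\ valid y' by split; apply: (cP k).1.
  have [m' x'y' _] := (cP k).2 _ _ Px' Py'.
  have c0 u v r : valid u -> valid v -> common u v r -> common u v 0.
    by move=> uV vV uvr; apply: (common_le HA uV vV uvr); have [r0 _ _ _] := uvr; lra.
  apply: (@common_trans _ _ _ _ _ x'); first exact: c0 xx'.
  apply: (@common_trans _ _ _ _ _ y'); first exact: c0 x'y'.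
  by apply: common_sym; apply: c0 yy'.
exists m => // t mt; split=> tx; first exact: (half x y m).
apply: (half y x m) => //; first exact: common_sym.
by move=> t' mt' t'y t'x /esym; apply: sep.
Qed.

(** Separation passes to limits: the strict inequality in [near_pt] leaves a slack, half of which is
    spent on approximating each of the two points. *)
Lemma limset_conflict s P Q : (forall k, P k `<=` valid) -> (forall k, Q k `<=` valid) ->
  @conflict _ _ depth anc s (limset F P) (limset F Q) ->
  exists k, @conflict _ _ depth anc s (P k) (Q k).
Proof.
move=> PV QV [x [y [[xV xP] [yV yQ] /near_lt[s' s's xy]]]].
pose eps := (s - s') / 2; have eps0 : 0 < eps by rewrite /eps; lra.
have [k [[x' Px' xx'] [y' Qy' yy']]] := filter_ex (filterI (xP _ eps0) (yQ _ eps0)).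
exists k, x', y'; split=> //.
have -> : s = eps + (s' + eps) by rewrite /eps; lra.
apply: (near_trans HA (y := x)) => //; [exact: (PV k)|exact: (QV k)|exact: near_sym|].
by apply: (near_trans HA (y := y)) => //; exact: (QV k).
Qed.

End Limits.

(** * The cake as a rooted tree *)

(** The rooting enters the remaining proof only through these four facts. The last one later shows
    that convex sets are pieces. *)
Lemma forest_cake_ancestry {R : realType} {V E : finType} (src tgt : E -> V)
    (len : E -> R) : (forall e, 0 < len e) -> cake_forest src tgt ->
  exists (depth : cake_pt -> R) (anc : cake_pt -> R -> cake_pt),
  [/\ ancestry (cake_valid len) depth anc,
    forall X, X `<=` @cake_valid R V E len ->
      (connected_piece src tgt len X <-> anc_convex (cake_valid len) depth anc X),
    forall s X Y, X `<=` cake_valid len -> Y `<=` cake_valid len ->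
      ((s%:E <= setDist src tgt len X Y)%E <-> ~ @conflict _ _ depth anc s X Y) &
    forall X e, anc_convex (cake_valid len) depth anc X ->
      is_interval [set t | 0 <= t <= len e /\ X (emb src tgt len e t)]].
Proof.
move=> len_pos /forest_rooting[c [p [rk [Jcp cI lt_rk]]]].
pose depth := cake_depth src tgt len cI lt_rk.
pose anc := cake_anc src tgt len cI lt_rk.
have HA : ancestry (cake_valid len) depth anc by exact: cake_ancestry.
have up := @walk_up _ _ _ _ _ _ len_pos _ _ _ Jcp cI lt_rk.
have link x y m : cake_valid len x -> cake_valid len y -> common_anc depth anc x y m ->
    exists w, [/\ walk src tgt len x y w, walk_len w = depth x + depth y - 2 * m &
      forall s z, s \in w -> seg_set src tgt len s z -> exists2 t, m <= t &
        (t <= depth x /\ z = anc x t) \/ (t <= depth y /\ z = anc y t)].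
  move=> xV yV [m0 mx my xy].
  have [|w [ww wl wP]] := up x m xV; first by rewrite m0.
  have [|w' [ww' wl' wP']] := up y m yV; first by rewrite m0.
  exists (w ++ rev (map (@seg_flip R E) w')); split.
  - apply: walk_cat ww _; rewrite -/anc xy; exact: walk_rev.
  - rewrite /walk_len big_cat -/(walk_len w) -/(walk_len (rev _)).
    by rewrite walk_rev_len wl wl' -/depth /=; lra.
  - move=> s z; rewrite mem_cat => /orP[sw sz|].
      by have [t /andP[mt tx] ->] := wP s z sw sz; exists t => //; left.
    rewrite mem_rev => /mapP[s' s'w ->]; rewrite seg_flip_set => sz.
    by have [t /andP[mt ty] ->] := wP' s' z s'w sz; exists t => //; right.
exists depth, anc; split=> //.
- move=> X XV; split=> [cX|[_ cX]].
    split=> // x y Xx Xy; have [w [ww wX]] := cX x y Xx Xy.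
    have [m [xy _ mX]] := walk_common_anc len_pos Jcp cI lt_rk (XV x Xx) Xx ww wX.
    by exists m.
  move=> x y Xx Xy; have [m xy mX] := cX x y Xx Xy.
  have [w [ww _ wP]] := link x y m (XV x Xx) (XV y Xy) xy.
  exists w; split=> // s sw z sz; have [t mt] := wP s z sw sz.
  by case=> -[tx ->]; [exact: (mX t mt).1|exact: (mX t mt).2].
- move=> s X Y XV YV; split.
    move=> le_s [x [y [Xx Yy [m xy lt_s]]]].
    have [w [ww wl _]] := link x y m (XV x Xx) (YV y Yy) xy.
    have : (s%:E <= (walk_len w)%:E)%E.
      apply: (le_trans le_s); apply: ge_ereal_inf; exists (Dist src tgt len x y).
        by exists x, y.
      by apply: ereal_inf_lbound; exists w.
    by rewrite lee_fin wl leNgt lt_s.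
  move=> nc; apply: le_ereal_inf_tmp => _ [x [y [Xx [Yy ->]]]].
  apply: le_ereal_inf_tmp => _ [w ww <-]; rewrite lee_fin leNgt; apply/negP => lt_s.
  have [//|m [xy le_w _]] :=
    walk_common_anc (X := setT) len_pos Jcp cI lt_rk (XV x Xx) I ww.
  by apply: nc; exists x, y; split=> //; exists m => //; apply: le_lt_trans lt_s.
- move=> X e [_ cX] t1 t2 [t1_in X1] [t2_in X2] t t_in.
  split; first lra.
  pose h := height src len p e.
  have embE t' : emb src tgt len e t' = pemb src tgt len p e (h t').
    by rewrite /pemb heightK.
  (* The upward path of the deeper point, at [u2], reaches at least as high as the point at [u1],
     hence passes through the one at [u]. *)
  have mono u1 u u2 : 0 <= u1 -> u1 <= u <= u2 -> u2 <= len e ->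
      X (pemb src tgt len p e u1) -> X (pemb src tgt len p e u2) ->
      X (pemb src tgt len p e u).
    move=> u10 u_in u2l Xu1 Xu2; have [m [_ _ mx _] mX] := cX _ _ Xu2 Xu1.
    rewrite -(pemb_anc len_pos Jcp cI lt_rk (u' := u2)); [|lra|lra].
    have du u' : 0 <= u' <= len e -> depth (pemb src tgt len p e u')
        = depth (PV (p e)) + u' by move=> ?; apply: depth_pemb.
    rewrite du in mx; last lra.
    by apply: (mX _ _).1; rewrite -/depth ?du; lra.
  have hl t' : 0 <= t' <= len e -> 0 <= h t' <= len e by rewrite height_itv.
  rewrite embE; rewrite embE in X1; rewrite embE in X2.
  have [h1 h2] := (hl _ t1_in, hl _ t2_in).
  have [h12|h21] : (h t1 <= h t <= h t2) \/ (h t2 <= h t <= h t1).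
    by rewrite /h /height; case: (p e == src e); [left|right]; lra.
  - by apply: mono X1 X2; lra.
  - by apply: mono X2 X1; lra.
Qed.

(** * The maximin share is attained *)

Lemma ultrafilter_lim {R : realType} {I : Type} (F : set_system I) (u : I -> R) a b :
  UltraFilter F -> (forall k, a <= u k <= b) ->
  exists l : R, forall eps, 0 < eps -> F [set k | `|u k - l| < eps].
Proof.
move=> FU u_in.
have FP : ProperFilter (u @ F) by exact: fmap_proper_filter.
have [|l [_ ul]] := @segment_compact R a b (u @ F) FP.
  suff : F (u @^-1` `[a, b]%classic) by [].
  by apply: filterE => k; rewrite /= in_itv /= u_in.
exists l => eps eps0; have [//|Fn] := in_ultra_setVsetC [set k | `|u k - l| < eps] FU.
have [|x [/= xn xl]] := ul [set x | ~ `|x - l| < eps] (ball (l : R) eps) Fn.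
  exact: nbhsx_ballx.
by case: xn; rewrite distrC.
Qed.

Section AttainedShare.
Context {R : realType} {V E : finType} (src tgt : E -> V) (len : E -> R).
Local Notation pt := (@cake_pt R V E).
Local Notation emb := (@emb R V E src tgt len).
Local Notation cpiece := (@piece R V E src tgt len).
Context (len_pos : forall e, 0 < len e).
Context (depth : pt -> R) (anc : pt -> R -> pt).
Local Notation valid := (@cake_valid R V E len).
Local Notation convex := (anc_convex valid depth anc).
Local Notation limit := (@limset R pt valid depth anc).
Context (HA : ancestry valid depth anc).
Context (connE : forall X, X `<=` valid -> (connected_piece src tgt len X <-> convex X)).
Context (distE : forall s X Y, X `<=` valid -> Y `<=` valid ->
  ((s%:E <= setDist src tgt len X Y)%E <-> ~ @conflict _ _ depth anc s X Y)).
Context (sliceP : forall X e, convex X ->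
  is_interval [set t | 0 <= t <= len e /\ X (emb e t)]).

Lemma piece_valid X : cpiece X -> X `<=` valid.
Proof.
move=> [ints [vs XE]] x /XE[[[e i] _ [t [_ [t_in ->]]]]|[v _ ->]] //.
exact: emb_valid.
Qed.

(** By [sliceP] the set meets each of the finitely many edges in an interval, which [Rhull] turns
    into a syntactic one. *)
Lemma convex_piece X : convex X -> cpiece X.
Proof.
move=> cX; pose slice e : set R := [set t | 0 <= t <= len e /\ X (emb e t)].
exists [seq (e, Rhull (slice e)) | e <- enum E].
exists [seq v <- enum V | `[< X (PV v) >]].
have sliceE e t : t \in Rhull (slice e) <-> slice e t.
  by have /is_intervalP := @sliceP X e cX; rewrite -/(slice e) => {2}->.
move=> x; split.
  case: x => [v Xv|e t Xet].
    by right; exists v => //; rewrite mem_filter mem_enum andbT; apply/asboolP.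
  have t_in := cX.1 _ Xet; left; exists (e, Rhull (slice e)).
    by apply/mapP; exists e; rewrite ?mem_enum.
  have t_in' : 0 <= t <= len e by move: t_in => /= t_in; lra.
  exists t; rewrite sliceE [(_, _).1]/= emb_in //.
  by split=> //; split=> //; rewrite emb_in.
case=> [[[e i] /mapP[e' _ [-> ->]] [t [/sliceE[_ Xt] [_ ->]]]]|[v vs ->]] //.
by move: vs; rewrite mem_filter => /andP[/asboolP].
Qed.

Lemma pieceU X Y : cpiece X -> cpiece Y -> cpiece (X `|` Y).
Proof.
move=> [i [v XE]] [i' [v' YE]]; exists (i ++ i'), (v ++ v') => x; split.
  case=> [/XE|/YE] [[ei ei_in H]|[w w_in H]]; [left|right|left|right].
  - by exists ei; rewrite ?mem_cat ?ei_in.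
  - by exists w; rewrite ?mem_cat ?w_in.
  - by exists ei; rewrite ?mem_cat ?ei_in ?orbT.
  - by exists w; rewrite ?mem_cat ?w_in ?orbT.
case=> [[ei]|[w]]; rewrite mem_cat => /orP[] H Hx.
- by left; apply/XE; left; exists ei.
- by right; apply/YE; left; exists ei.
- by left; apply/XE; right; exists w.
- by right; apply/YE; right; exists w.
Qed.

Lemma cake_valid_piece : cpiece valid.
Proof.
exists [seq (e, `[0, len e]) | e <- enum E], (enum V) => x; split.
  case: x => [v _|e t /= t_in]; first by right; exists v; rewrite ?mem_enum.
  left; exists (e, `[0, len e]); first by apply/mapP; exists e; rewrite ?mem_enum.
  by exists t; rewrite /= in_itv /= emb_in //; split; [lra|split=> //; lra].
by case=> [[ei _ [t [_ [t_in ->]]]]|[v _ ->]] //; exact: emb_valid.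
Qed.

Definition open_slice (X : set pt) e : set R := [set t | 0 < t < len e /\ X (PE e t)].

Lemma open_slice_interval X e : convex X -> is_interval (open_slice X e).
Proof.
move=> cX t1 t2 [t1_in X1] [t2_in X2] t t_in; have t_in' : 0 < t < len e by lra.
split=> //; rewrite -(emb_in src tgt (len := len)) //.
have [||_] // := @sliceP X e cX t1 t2 _ _ t t_in.
- by split; [lra|rewrite emb_in].
- by split; [lra|rewrite emb_in].
Qed.

(* Along an ultrafilter the endpoints of the slices [P k] of an edge converge,
   and everything strictly between the two limits belongs to the limit set. *)
Lemma limit_slice_excess (F : set_system nat) (P : nat -> set pt) e eps :
  UltraFilter F -> (forall k, convex (P k)) -> 0 < eps ->
  F [set k | (@lebesgue_measure R [set t : R | (0 < t < len e)%R /\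
     ~ (limit F P (PE e t) <-> (limit F P `|` P k) (PE e t))] <= eps%:E)%E].
Proof.
move=> FU cP eps0; set L := limit F P.
have cL : convex L by exact: (limset_convex HA cP).
pose I k := open_slice (P k) e.
have DE k : [set t : R | 0 < t < len e /\ ~ (L (PE e t) <-> (L `|` P k) (PE e t))]
    = I k `\` open_slice L e.
  apply/seteqP; split=> t /=.
    move=> [t_in nLP]; split; last by move=> [_ Lt]; apply: nLP; split=> // _; left.
    split=> //; apply: contrapT => nPt; apply: nLP; split=> [Lt|[]//]; by left.
  move=> [[t_in Pt] nLt]; split=> // -[_ LPL].
  by apply: nLt; split=> //; apply: LPL; right.
under [X in F X]eq_set do rewrite DE.
have mI k : measurable (I k).
  by apply: is_interval_measurable; exact: open_slice_interval.
have mL : measurable (open_slice L e).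
  by apply: is_interval_measurable; exact: open_slice_interval.
have [F0|F0] := in_ultra_setVsetC [set k | I k = set0] FU.
  by apply: filterS F0 => k /= ->; rewrite set0D measure0 lee_fin ltW.
have I_in k t : I k t -> 0 <= t <= len e by case; lra.
have lbI k : has_lbound (I k) by exists 0 => t /I_in/andP[].
have ubI k : has_ubound (I k) by exists (len e) => t /I_in/andP[].
have hasI k : I k !=set0 -> 0 <= inf (I k) <= len e /\ 0 <= sup (I k) <= len e.
  move=> I0; have [t It] := I0; have := I_in k t It.
  have := ge_inf (lbI k) It; have := ub_le_sup (ubI k) It.
  have : 0 <= inf (I k) by apply: lb_le_inf => // t' /I_in/andP[].
  have : sup (I k) <= len e by apply: ge_sup => // t' /I_in/andP[].
  by move=> ? ? ? ? ?; split; lra.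
(* An empty slice has infimum and supremum 0 by convention, so the bounds hold for every [k]. *)
have inf_in k : 0 <= inf (I k) <= len e.
  have [I0|/set0P/hasI[]//] := eqVneq (I k) set0.
  by rewrite I0 inf0 lexx ltW.
have sup_in k : 0 <= sup (I k) <= len e.
  have [I0|/set0P/hasI[]//] := eqVneq (I k) set0.
  by rewrite I0 sup0 lexx ltW.
have [a aP] := ultrafilter_lim FU inf_in.
have [b bP] := ultrafilter_lim FU sup_in.
have mid t : a < t < b -> 0 < t < len e -> L (PE e t).
  move=> /andP[ta tb] t_in; split=> // r r0.
  have Fa := aP (t - a) ltac:(lra); have Fb := bP (b - t) ltac:(lra).
  apply: filterS (filterI F0 (filterI Fa Fb)) => k [/= /eqP/set0P I0 [ka kb]].
  have inft : inf (I k) < t by move: ka; rewrite ltr_norml; lra.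
  have supt : t < sup (I k) by move: kb; rewrite ltr_norml; lra.
  have [t1 It1 t1t] := inf_lt I0 inft; have [t2 It2 tt2] := sup_gt I0 supt.
  have [|_ Pt] := open_slice_interval (cP k) It1 It2 (z := t); first lra.
  by exists (PE e t) => //; exact: (near_refl HA).
(* The excess lies within [z] of the two limit endpoints, hence in two intervals of length [2 * z],
   of total length [eps]. *)
pose z := eps / 4; have z0 : 0 < z by rewrite /z; lra.
apply: filterS (filterI F0 (filterI (aP z z0) (bP z z0))) => k [_ [/= ka kb]].
have sub : I k `\` open_slice L e `<=` `[a - z, a + z] `|` `[b - z, b + z].
  move=> t [It nLt]; have [t_in Pt] := It.
  have := ge_inf (lbI k) It; have := ub_le_sup (ubI k) It.
  move: ka kb; rewrite !ltr_norml => ka kb tsup inft.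
  have [ta|a_t] := leP t a; first by left; rewrite /= in_itv /=; lra.
  have [bt|tb] := leP b t; first by right; rewrite /= in_itv /=; lra.
  by case: nLt; split=> //; apply: mid => //; rewrite a_t.
apply: (@le_trans _ _ (@lebesgue_measure R (`[a - z, a + z] `|` `[b - z, b + z])%classic)).
  apply: le_measure => //; rewrite inE; first by apply: measurableD; [exact: mI|exact: mL].
  by apply: measurableU; exact: measurable_itv.
have mz (x : R) : @lebesgue_measure R `[x - z, x + z]%classic = (2 * z)%:E.
  rewrite lebesgue_measure_itv /= lte_fin ifT -?EFinB; last lra.
  by congr EFin; lra.
have -> : eps%:E = ((2 * z)%R%:E + (2 * z)%R%:E)%E by rewrite -EFinD /z; congr EFin; lra.
rewrite -{1}(mz a) -(mz b); apply: measureU2; exact: measurable_itv.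
Qed.

(** The union of the limit [L] with [P k] is compared with both: by monotonicity it is worth at
    least as much as [P k], and by continuity little more than [L], as its excess over [L] is
    short. *)
Lemma limit_value (F : set_system nat) (P : nat -> set pt) v r :
  UltraFilter F -> cake_valuation src tgt len v ->
  (forall k, cpiece (P k)) -> (forall k, convex (P k)) ->
  (forall eps, 0 < eps -> F [set k | r - eps < v (P k)]) -> r <= v (limit F P).
Proof.
move=> FU [_ [v_mono [v_cont _]]] pP cP vP; set L := limit F P.
have cL : convex L by exact: (limset_convex HA cP).
have pL := convex_piece cL.
apply/ler_addgt0Pr => eps eps0.
have e2 : 0 < eps / 2 by lra.
have [d d0 dP] := v_cont L pL (eps / 2) e2.
have E0 : 0 <= #|E|%:R :> R by [].
(* Chosen so that [#|E|] slices of excess at most [w] add up to less than [d]; the [+ 1] covers a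
   cake without edges. *)
pose w := d / (2 * (#|E|%:R + 1)); have w0 : 0 < w by rewrite divr_gt0 //; lra.
have FE : F [set k | forall e, (@lebesgue_measure R [set t : R | (0 < t < len e)%R /\
     ~ (L (PE e t) <-> (L `|` P k) (PE e t))] <= w%:E)%E].
  by apply: filter_forall => e; exact: limit_slice_excess.
have [k [/= kE vk]] := filter_ex (filterI FE (vP (eps / 2) e2)).
have small : (symdiff_len len L (L `|` P k) < d%:E)%E.
  apply: (@le_lt_trans _ _ (\sum_(e : E) w%:E)%E); first exact: lee_sum.
  rewrite sumEFin sumr_const lte_fin -mulr_natr cardT -cardE.
  have dE : d = 2 * (w * #|E|%:R) + 2 * w.
    by rewrite /w; field; apply: lt0r_neq0; lra.
  have : 0 <= w * #|E|%:R by rewrite mulr_ge0 // ltW.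
  lra.
have := dP _ (pieceU pL (pP k)) small; rewrite ltr_norml.
have := v_mono _ _ (pP k) (pieceU pL (pP k)) (@subsetUr _ L (P k)).
by lra.
Qed.

(** Disjointness is absorbed by the absence of conflicts, because a common point would be at
    distance 0, less than [s]. *)
Lemma separatedE n s (P : 'I_n -> set pt) : 0 < s ->
  cake_separated src tgt len s P <->
  (forall j, cpiece (P j) /\ convex (P j)) /\
  (forall i j, i != j -> ~ @conflict _ _ depth anc s (P i) (P j)).
Proof.
move=> s0; split=> -[Ppc Psep]; split.
- move=> j; have [pj cj] := Ppc j; split=> //.
  by apply/connE => //; exact: piece_valid.
- move=> i j /Psep[_ d]; apply/distE => //; apply: piece_valid; exact: (Ppc _).1.
- move=> j; have [pj cj] := Ppc j; split=> //.
  by apply/connE => //; exact: piece_valid.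
- move=> i j /Psep nc; split; last first.
    by apply/distE => //; apply: piece_valid; exact: (Ppc _).1.
  apply/seteqP; split=> // x [Pix Pjx]; case: nc; exists x, x; split=> //.
  by apply: (near_refl HA) => //; exact: (piece_valid (Ppc i).1).
Qed.

(** The share is finite, lying between 0, from empty pieces, and the value of the whole cake.
    Partitions whose parts are worth more than the share minus [1 / (k + 1)] then converge, part by
    part, to one attaining it. *)
Lemma MMS_attained n s v : (0 < n)%N -> 0 < s -> cake_valuation src tgt len v ->
  exists P : 'I_n -> set pt, cake_separated src tgt len s P /\
    forall j, (cake_MMS src tgt len v n s <= (v (P j))%:E)%E.
Proof.
move=> n0 s0 Hv; have [v_ge0 [v_mono _]] := Hv.
have c0 : convex set0 by split=> // x y [].
have sep0 : cake_separated src tgt len s (fun _ : 'I_n => set0).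
  apply/separatedE => //; split=> [j|i j _ [x [y []]]] //.
  by split=> //; exact: convex_piece.
have MMS_ge : (0%:E <= cake_MMS src tgt len v n s)%E.
  apply: le_ereal_sup_tmp; exists (min_value v (fun _ : 'I_n => set0)).
    by exists (fun=> set0).
  by apply: le_ereal_inf_tmp => _ [j _ <-]; rewrite lee_fin v_ge0 //; exact: convex_piece.
have MMS_le : (cake_MMS src tgt len v n s <= (v valid)%:E)%E.
  apply: ge_ereal_sup => _ [P sepP <-]; apply: ge_ereal_inf.
  exists (v (P (Ordinal n0)))%:E; first by exists (Ordinal n0).
  have [pP _] := sepP.1 (Ordinal n0).
  by rewrite lee_fin v_mono //; [exact: cake_valid_piece|exact: piece_valid].
have fin : cake_MMS src tgt len v n s \is a fin_num.
  by rewrite fin_numElt (lt_le_trans _ MMS_ge) ?ltNyr // (le_lt_trans MMS_le) ?ltry.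
pose r := fine (cake_MMS src tgt len v n s).
have rE : cake_MMS src tgt len v n s = r%:E by rewrite fineK.
have seqP k : exists P : 'I_n -> set pt, cake_separated src tgt len s P /\
    forall j, r - k.+1%:R^-1 < v (P j).
  have [|_ [P sepP <-] ltP] := @ub_ereal_sup_adherent R _ k.+1%:R^-1 _ fin.
    by rewrite invr_gt0.
  exists P; split=> // j; rewrite -lte_fin EFinB -rE.
  by apply: (lt_le_trans ltP); apply: ereal_inf_lbound; exists j.
have [Q QP] := choice seqP.
(* An ultrafilter containing all tails, the same for all parts, so that a conflict between two
   limits shows up at a single [k]. *)
have [F [FU Foo]] := ultraFilterLemma (eventually_filter : ProperFilter \oo).
have /= sepQ k := (separatedE _ s0).1 (QP k).1.
exists (fun j => limit F (fun k => Q k j)); split.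
  apply/separatedE => //; split=> [j|i j ij].
    have cL : convex (limit F (fun k => Q k j)).
      by apply: (limset_convex HA) => k; exact: ((sepQ k).1 j).2.
    by split=> //; exact: convex_piece.
  move=> /(limset_conflict HA)[k|k|k].
  - exact: ((sepQ k).1 i).2.1.
  - exact: ((sepQ k).1 j).2.1.
  - exact: (sepQ k).2.
move=> j; rewrite rE lee_fin; apply: limit_value => //.
- by move=> k; exact: ((sepQ k).1 j).1.
- by move=> k; exact: ((sepQ k).1 j).2.
move=> eps eps0; apply: Foo.
apply: filterS (near_infty_natSinv_lt (PosNum eps0)) => k /= lt_k.
by apply: lt_trans ((QP k).2 j); rewrite ltrD2l ltrN2.
Qed.

End AttainedShare.

(** * Conflict-free choice from the maximin partitions *)

Theorem theorem3 (R : realType) (V E : finType) (src tgt : E -> V) (len : E -> R)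
  (len_pos : forall e, 0 < len e) (Hforest : cake_forest src tgt)
  (s : R) (s_pos : 0 < s) (n : nat) (n_pos : (1 <= n)%N)
  (v : 'I_n -> set (@cake_pt R V E) -> R)
  (Hv : forall i, cake_valuation src tgt len (v i)) :
  exists A : 'I_n -> set (@cake_pt R V E),
    cake_separated src tgt len s A /\
    forall i, (cake_MMS src tgt len (v i) n s <= (v i (A i))%:E)%E.
Proof.
have [depth [anc [HA connE distE sliceP]]] := forest_cake_ancestry len_pos Hforest.
have sepE := separatedE HA connE distE _ s_pos.
have [P PP] := choice (fun i =>
  MMS_attained len_pos HA connE distE sliceP n_pos s_pos (Hv i)).
have sepP i := (sepE n (P i)).1 (PP i).1.
(* An empty piece gets the default infimum 0, which is harmless since pieces in conflict are
   nonempty. *)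
pose top (i j : 'I_n) := inf (depth @` P i j).
have topP i j : P i j !=set0 -> [/\ 0 <= top i j,
    forall x, P i j x -> top i j <= depth x &
    forall eps, 0 < eps -> exists2 x, P i j x & depth x < top i j + eps].
  move=> P0; have D0 : depth @` P i j !=set0 by exact: image_nonempty.
  have lbD : lbound (depth @` P i j) 0.
    by move=> _ [x Px <-]; apply: (depth_ge0 HA); exact: ((sepP i).1 j).2.1.
  split; first exact: lb_le_inf.
    by move=> x Px; apply: ge_inf; [exists 0|exists x].
  move=> eps eps0; have [|_ [x Px <-] lt_x] := inf_adherent eps0 (E := depth @` P i j).
    by split=> //; exists 0.
  by exists x.
pose C i j i' j' := @conflict _ _ depth anc s (P i j) (P i' j').
have Csym i j i' j' : C i j i' j' -> C i' j' i j by exact: conflict_sym.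
have Csimp i j i' j1 j2 : top i' j1 <= top i j -> top i' j2 <= top i j ->
    C i j i' j1 -> C i j i' j2 -> j1 = j2.
  move=> t1 t2 C1 C2; apply/eqP/negP => /negP j12.
  (* Otherwise two different parts of the separated partition of [i'] would be in conflict. *)
  apply: ((sepP i').2 _ _ j12).
  have [P0 Q10] : P i j !=set0 /\ P i' j1 !=set0.
    by case: C1 => x [y [Px Qy _]]; split; [exists x|exists y].
  have Q20 : P i' j2 !=set0 by case: C2 => x [y [_ Qy _]]; exists y.
  have [H0 Hle Htop] := topP _ _ P0.
  apply: (deepest_simplicial HA s_pos H0 _ _ _ Hle _ C1 C2).
  - exact: ((sepP i).1 j).2.
  - exact: ((sepP i').1 j1).2.
  - exact: ((sepP i').1 j2).2.
  have below j' eps : P i' j' !=set0 -> top i' j' <= top i j -> 0 < eps ->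
      exists2 x, P i' j' x & depth x < top i j + eps.
    move=> /topP[_ _ tj'] le_t /tj'[x Px lt_x]; exists x => //.
    by apply: (lt_le_trans lt_x); rewrite lerD2r.
  move=> X; rewrite !inE => /or3P[] /eqP-> eps eps0; first exact: Htop.
  - exact: below.
  - exact: below.
have [|f [_ fC]] := simplicial_selection (Ordinal n_pos) Csym Csimp
    (S := [set: 'I_n]%SET) (J := fun=> [set: 'I_n]%SET); first by [].
exists (fun i => P i (f i)); split.
  apply/sepE; split=> [i|i j ij]; first exact: (sepP i).1.
  by apply: fC; rewrite ?inE.
by move=> i; apply: (PP i).2.
Qed.
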